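(* Let $G$ be an $n\times n$ matrix function on $\mathbb{R}$ admitting a bounded factorization $G=G_-DG_+^{-1}$, $D=\mathrm{diag}[d_1,\ldots,d_n]$, let $g$ be a given $n$-vector function on $\mathbb{R}$, and let $p\in[1,\infty]$. Denote by $g_j^\pm$ the $j$-th column of $G_\pm$. Then all solutions of the problem $$\phi_-=G\phi_++g \quad\text{on } \mathbb{R}$$ satisfying $\phi_\pm\in (H_p^\pm)^n$ are given by $$\phi_+=\sum_j \psi_jg_j^+,\qquad \phi_-=\sum_j d_j\psi_jg_j^-+g,$$ where each $\psi_j$ ($j=1,\ldots,n$) is an arbitrary function satisfying $$\psi_j\in H_p^+,\qquad d_j\psi_j+(G_-^{-1}g)_j\in H_p^-.$$
   Context: $\mathbb{C}^\pm=\{z\in\mathbb{C}:\pm\mathrm{Im}\, z>0\}$; $H_r^\pm$ ($0<r\le\infty$) are the Hardy classes in $\mathbb{C}^\pm$, whose elements are identified with their boundary values on $\mathbb{R}$. $X^n$ ($X^{n\times n}$) denotes $n$-vectors ($n\times n$ matrices) with entries in $X$. A bounded factorization of $G$ is a representation $G=G_-DG_+^{-1}$ on $\mathbb{R}$ with $G_+^{\pm1}\in(H_\infty^+)^{n\times n}$, $G_-^{\pm1}\in(H_\infty^-)^{n\times n}$ and $D=\mathrm{diag}[d_1,\ldots,d_n]$ a diagonal matrix function on $\mathbb{R}$; no a priori conditions are imposed on the functions $d_j$. $(G_-^{-1}g)_j$ is the $j$-th entry of $G_-^{-1}g$. *)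

(* Defs.v *)
From HB Require Import structures.
From mathcomp Require Import all_boot all_order all_algebra.
From mathcomp Require Import complex.
From mathcomp Require Import all_classical all_reals all_analysis.

Set Implicit Arguments.
Unset Strict Implicit.
Unset Printing Implicit Defensive.

Import Order.TTheory GRing.Theory Num.Theory numFieldNormedType.Exports.

Local Open Scope classical_set_scope.
Local Open Scope complex_scope.
Local Open Scope ring_scope.

Section Hardy.
Context {R : realType}.

Definition upper_half_plane : set R[i] := [set z | 0 < complex.Im z].
Definition lower_half_plane : set R[i] := [set z | complex.Im z < 0].

(* [R[i]^o] is [R[i]] as a normed space over itself, so that the derivative in
   direction 1 is the complex derivative. *)
Definition holomorphic_on (Omega : set R[i]) (F : R[i] -> R[i]) : Prop :=
  forall z : R[i], Omega z -> derivable (F : R[i]^o -> R[i]^o) (z : R[i]^o) 1.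

(* For a half-plane Omega = C^+ or C^- and 0 < r <= +oo:
     sup_y \int |F (x + i y)|^r dx < +oo   if r < +oo,
     sup_Omega |F| < +oo                   if r = +oo,
   y ranging over the reals with i y in Omega.  Other exponents are not
   meaningful. *)
Definition hardy_bound (Omega : set R[i]) (r : \bar R) (F : R[i] -> R[i]) :
    Prop :=
  match r with
  | r0%:E => exists M : R, forall y : R, Omega (0 +i* y) ->
      (\int[lebesgue_measure]_x ((Normc.normc (F (x +i* y))) `^ r0)%:E
         <= M%:E)%E
  | +oo%E => exists M : R, forall z : R[i], Omega z -> Normc.normc (F z) <= M
  | -oo%E => False
  end.

(* The part of Omega in the cone of aperture [a] with vertex [x] on the real
   line. *)
Definition stolz_cone (Omega : set R[i]) (a x : R) : set R[i] :=
  [set z | Omega z /\ `|complex.Re z - x| < a * `|complex.Im z| ].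

Definition nontangential_limit (Omega : set R[i]) (F : R[i] -> R[i])
    (x : R) (l : R[i]) : Prop :=
  forall a : R, 0 < a ->
    (F : R[i]^o -> R[i]^o) @ within (stolz_cone Omega a x) (nbhs (x%:C : R[i]^o))
      --> (l : R[i]^o).

(* Hardy functions are identified with their boundary values: [f] is a function
   on the real line, determined up to a null set. *)
Definition hardy (Omega : set R[i]) (r : \bar R) (f : R -> R[i]) : Prop :=
  exists F : R[i] -> R[i],
    [/\ holomorphic_on Omega F,
        hardy_bound Omega r F &
        {ae lebesgue_measure,
          forall x : R, nontangential_limit Omega F x (f x)}].

Definition hardy_mx (Omega : set R[i]) (r : \bar R) (m n : nat)
    (A : R -> 'M[R[i]]_(m, n)) : Prop :=
  forall i j, hardy Omega r (fun x => A x i j).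

Definition diag_fun (n : nat) (d : 'I_n -> R -> R[i]) (x : R) : 'M[R[i]]_n :=
  diag_mx (\row_j d j x).

(* [Gm], [Gp] stand for G_-, G_+.  As [invmx] of a singular matrix is that
   matrix itself, pointwise invertibility (a.e.) is required explicitly. *)
Definition bounded_factorization (n : nat) (G Gm : R -> 'M[R[i]]_n)
    (d : 'I_n -> R -> R[i]) (Gp : R -> 'M[R[i]]_n) : Prop :=
  [/\ {ae lebesgue_measure, forall x : R, Gp x \in unitmx /\ Gm x \in unitmx},
      hardy_mx upper_half_plane +oo%E Gp /\
        hardy_mx upper_half_plane +oo%E (fun x => invmx (Gp x)),
      hardy_mx lower_half_plane +oo%E Gm /\
        hardy_mx lower_half_plane +oo%E (fun x => invmx (Gm x)) &
      {ae lebesgue_measure, forall x : R,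
        G x = Gm x *m diag_fun d x *m invmx (Gp x)}].

End Hardy.

(* Main.v *)
Require Import Defs.
From HB Require Import structures.
From mathcomp Require Import all_boot all_order all_algebra.
From mathcomp Require Import complex.
From mathcomp Require Import all_classical all_reals all_analysis.
From mathcomp Require Import measurable_realfun.

Import Order.TTheory GRing.Theory Num.Theory numFieldNormedType.Exports.

Local Open Scope classical_set_scope.
Local Open Scope complex_scope.
Local Open Scope ring_scope.

(** The substitution psi = G_+^-1 phi_+ diagonalizes the problem.  Multiplying
    phi_- = G_- D G_+^-1 phi_+ + g on the left by G_-^-1 gives
      G_-^-1 phi_- = D psi + G_-^-1 g,
    a system that decouples into n scalar relations between psi_j in H_p^+ and
    d_j psi_j + (G_-^-1 g)_j in H_p^-.  Since the identities hold a.e. on the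
    real line, the only analytic content is that multiplication by G_+, G_-
    and their inverses preserves the vector classes H_p of the corresponding
    half-plane, that is, that H_p is a vector space stable under
    multiplication by H_oo ([hardyD], [hardyM], [hardy_mx_mulmx]).

    This is checked on the analytic extensions to the half-plane:
    holomorphy and nontangential limits pass to sums and products, and so does
    the H_p bound: |F1 + F2|^r <= 2^r (|F1|^r + |F2|^r) for sums and
    |F1 F2|^r <= M^r |F2|^r for a factor F1 bounded by M.  Integrating these
    over a horizontal line requires measurability of |F|^r there, which
    follows from the continuity of holomorphic functions. *)

Set Implicit Arguments.
Unset Strict Implicit.

(** * Almost everywhere statements and the modulus on the complex plane *)

(** The carrier of the Lebesgue measure is a generated sigma-algebra, through
    which instance search does not unfold; stating the instance directly lets
    the filter lemmas apply to a.e. statements. *)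
#[local] Instance lebesgue_ae_filter (R : realType) :
  Filter (nbhs (almost_everywhere (@lebesgue_measure R))).
Proof. exact: ae_filter_ringOfSetsType. Qed.

Lemma normCE (R : rcfType) (z : R[i]) : `|z| = (Normc.normc z)%:C.
Proof. by case: z. Qed.

Lemma normc_ge0 (R : rcfType) (z : R[i]) : 0 <= Normc.normc z.
Proof. by rewrite -lecR -normCE; exact: normr_ge0. Qed.

Lemma continuous_horizontal_line (R : realType) (y : R) :
  continuous ((fun x : R => x +i* y) : R -> R[i]^o).
Proof.
move=> x; apply/cvgrPdist_lt => -[e e'] /=; rewrite ltcE /= => /andP[/eqP -> e0].
near=> t.
have -> : (x +i* y : R[i]) - (t +i* y) = (x - t)%:C.
  by apply/eqP; rewrite eq_complex /= subrr !eqxx.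
rewrite normCE ltcR /= expr0n addr0 sqrtr_sqr.
by near: t; exact: cvgr_dist_lt.
Unshelve. all: by end_near. Qed.

Lemma continuous_normc (R : realType) :
  continuous (@Normc.normc R : R[i]^o -> R).
Proof.
move=> z; apply/(@cvgrPdist_lt _ _ _ (nbhs (z : R[i]^o))) => e e0.
have e0' : 0 < e%:C :> R[i] by rewrite ltcR.
have : \forall w \near (z : R[i]^o), `|z - w| < e%:C.
  by apply/(@nbhs_normP _ R[i]^o); exists e%:C.
apply: filterS => w /=; rewrite -ltcR; apply: le_lt_trans.
have := ler_dist_dist z w; rewrite !normCE -rmorphB /=.
by rewrite expr0n addr0 sqrtr_sqr.
Qed.

(** * Hardy classes of half-planes *)

Section HardyClasses.
(** The upper and the lower half-plane are treated together: all that is used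
    about them is that they are unions of horizontal lines. *)
Variables (R : realType) (Omega : set R[i]).
Hypothesis horizontal : forall x y : R, Omega (0 +i* y) -> Omega (x +i* y).

Lemma holomorphic_onD F1 F2 : holomorphic_on Omega F1 ->
  holomorphic_on Omega F2 -> holomorphic_on Omega (F1 \+ F2).
Proof. by move=> h1 h2 z Oz; exact: (derivableD (h1 _ Oz) (h2 _ Oz)). Qed.

Lemma holomorphic_onM F1 F2 : holomorphic_on Omega F1 ->
  holomorphic_on Omega F2 -> holomorphic_on Omega (F1 \* F2).
Proof. by move=> h1 h2 z Oz; exact: (derivableM (h1 _ Oz) (h2 _ Oz)). Qed.

Lemma measurable_line_powR (F : R[i] -> R[i]) (y r : R) :
    holomorphic_on Omega F -> Omega (0 +i* y) ->
  measurable_fun [set: R] (fun x => (Normc.normc (F (x +i* y)) `^ r)%:E).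
Proof.
move=> hF Oy; apply/measurable_EFinP.
apply: (measurableT_comp (measurable_powR r)).
apply: continuous_measurable_fun => x.
apply: (@continuous_comp R R[i]^o R (fun x => F (x +i* y))); last first.
  exact: continuous_normc.
apply: (@continuous_comp R R[i]^o R[i]^o (fun x => x +i* y) F).
  exact: continuous_horizontal_line.
by apply: differentiable_continuous; apply/derivable1_diffP/hF/horizontal.
Qed.

(** Both summands are at most their maximum, so the left-hand side is at most
    [(2 * max a b) `^ r].  The constant is not sharp, but holds for all
    [r >= 0]. *)
Lemma powRD_le (r a b : R) : 0 <= r -> 0 <= a -> 0 <= b ->
  (a + b) `^ r <= 2 `^ r * (a `^ r + b `^ r).
Proof.
move=> r0 a0 b0.
wlog ab : a b a0 b0 / a <= b.
  move=> H; case/orP: (le_total a b) => ab; first exact: H.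
  by rewrite addrC [X in _ * X]addrC; exact: H.
rewrite (@le_trans _ _ ((2 * b) `^ r)) //.
  apply: ge0_ler_powR; rewrite ?nnegrE ?addr_ge0 ?mulr_ge0 //.
  by rewrite mulr2n mulrDl !mul1r lerD2r.
by rewrite powRM // ler_wpM2l ?powR_ge0 // lerDr powR_ge0.
Qed.

(** The L^r norm on each line is estimated by [powRD_le] rather than by
    Minkowski's inequality, as only boundedness uniformly in the line matters. *)
Lemma hardy_boundD p F1 F2 : (1 <= p)%E ->
    holomorphic_on Omega F1 -> holomorphic_on Omega F2 ->
    hardy_bound Omega p F1 -> hardy_bound Omega p F2 ->
  hardy_bound Omega p (F1 \+ F2).
Proof.
case: p => [r| |] /=; [| |by []]; last first.
  move=> _ _ _ [M1 h1] [M2 h2]; exists (M1 + M2) => z Oz /=.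
  by rewrite (le_trans (le_normcD _ _)) // lerD ?h1 ?h2.
rewrite lee_fin => r1 hol1 hol2 [M1 h1] [M2 h2].
have r0 : 0 <= r by rewrite (le_trans _ r1).
exists (2 `^ r * (M1 + M2)) => y Oy.
have m1 := measurable_line_powR r hol1 Oy.
have m2 := measurable_line_powR r hol2 Oy.
apply: (@le_trans _ _ (\int[lebesgue_measure]_x ((2 `^ r)%:E *
  ((Normc.normc (F1 (x +i* y)) `^ r)%:E +
   (Normc.normc (F2 (x +i* y)) `^ r)%:E)))%E).
  apply: ge0_le_integral => //.
  - by move=> x _; rewrite lee_fin powR_ge0.
  - exact: measurable_line_powR (holomorphic_onD hol1 hol2) Oy.
  - by apply: measurable_funeM; exact: emeasurable_funD.
  - move=> x _; rewrite -EFinD -EFinM lee_fin.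
    apply: le_trans (powRD_le r0 (normc_ge0 _) (normc_ge0 _)).
    by apply: ge0_ler_powR; rewrite ?nnegrE ?addr_ge0 ?normc_ge0 ?le_normcD.
rewrite ge0_integralZl_EFin ?powR_ge0 //; last 2 first.
  by move=> x _; rewrite adde_ge0 // lee_fin powR_ge0.
  exact: emeasurable_funD.
rewrite ge0_integralD //; try by move=> x _; rewrite lee_fin powR_ge0.
rewrite EFinM EFinD lee_wpmul2l ?lee_fin ?powR_ge0 //.
by apply: leeD; [exact: h1|exact: h2].
Qed.

Lemma hardy_boundM p F1 F2 : (1 <= p)%E ->
    holomorphic_on Omega F1 -> holomorphic_on Omega F2 ->
    hardy_bound Omega +oo F1 -> hardy_bound Omega p F2 ->
  hardy_bound Omega p (F1 \* F2).
Proof.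
case: p => [r| |] /=; [| |by []]; last first.
  move=> _ _ _ [M1 h1] [M2 h2]; exists (M1 * M2) => z Oz /=.
  by rewrite Normc.normcM ler_pM ?normc_ge0 ?h1 ?h2.
rewrite lee_fin => r1 hol1 hol2 [M1 h1] [M2 h2].
have r0 : 0 <= r by rewrite (le_trans _ r1).
exists (M1 `^ r * M2) => y Oy.
(* Omega contains a point, so the bound M1 on |F1| is nonnegative. *)
have M10 : 0 <= M1 by apply: le_trans (h1 _ Oy); exact: normc_ge0.
have m2 := measurable_line_powR r hol2 Oy.
apply: (@le_trans _ _ (\int[lebesgue_measure]_x ((M1 `^ r)%:E *
  (Normc.normc (F2 (x +i* y)) `^ r)%:E))%E).
  apply: ge0_le_integral => //.
  - by move=> x _; rewrite lee_fin powR_ge0.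
  - exact: measurable_line_powR (holomorphic_onM hol1 hol2) Oy.
  - exact: measurable_funeM.
  - move=> x _; rewrite -EFinM lee_fin Normc.normcM powRM ?normc_ge0 //.
    rewrite ler_wpM2r ?powR_ge0 // ge0_ler_powR ?nnegrE ?normc_ge0 //.
    exact/h1/horizontal.
rewrite ge0_integralZl_EFin ?powR_ge0 //; last first.
  by move=> x _; rewrite lee_fin powR_ge0.
rewrite EFinM; apply: lee_wpmul2l; last exact: h2.
by rewrite lee_fin powR_ge0.
Qed.

(** The boundary function is only constrained a.e., so the same extension
    serves for both functions. *)
Lemma hardy_ae p (f h : R -> R[i]) :
    {ae lebesgue_measure, forall x : R, f x = h x} ->
  hardy Omega p f -> hardy Omega p h.
Proof.
move=> fh [F [hol bd lim]]; exists F; split; [exact: hol|exact: bd|].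
by apply: filterS2 fh lim => x <-.
Qed.

Lemma hardy0 p : (1 <= p)%E -> hardy Omega p (fun=> 0).
Proof.
move=> p1; exists (fun=> 0); split.
- by move=> z _; exact: (@derivable_cst _ R[i]^o R[i]^o 0).
- rewrite /hardy_bound; case: p p1 => [r| |]; [| |by []]; last first.
    by move=> _; exists 0 => z _; rewrite Normc.normc0.
  rewrite lee_fin => r1; exists 0 => y _.
  rewrite (eq_integral (cst 0%E)) ?integral0 // => x _.
  by rewrite Normc.normc0 powR0 // gt_eqF // (lt_le_trans _ r1).
- by apply: aeW => x a _; exact: (@cvg_cst R[i]^o).
Qed.

Lemma hardyD p f1 f2 : (1 <= p)%E -> hardy Omega p f1 -> hardy Omega p f2 ->
  hardy Omega p (f1 \+ f2).
Proof.
move=> p1 [F1 [hol1 bd1 lim1]] [F2 [hol2 bd2 lim2]]; exists (F1 \+ F2); split.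
- exact: holomorphic_onD.
- exact: hardy_boundD.
- apply: filterS2 lim1 lim2 => x l1 l2 a a0.
  exact: (cvgD (l1 a a0) (l2 a a0)).
Qed.

Lemma hardyM p f1 f2 : (1 <= p)%E -> hardy Omega +oo f1 -> hardy Omega p f2 ->
  hardy Omega p (f1 \* f2).
Proof.
move=> p1 [F1 [hol1 bd1 lim1]] [F2 [hol2 bd2 lim2]]; exists (F1 \* F2); split.
- exact: holomorphic_onM.
- exact: hardy_boundM.
- apply: filterS2 lim1 lim2 => x l1 l2 a a0.
  exact: (cvgM (l1 a a0) (l2 a a0)).
Qed.

Lemma hardy_sum p (I : finType) (f : I -> R -> R[i]) : (1 <= p)%E ->
  (forall i, hardy Omega p (f i)) -> hardy Omega p (fun x => \sum_i f i x).
Proof.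
move=> p1 hf; have -> : (fun x => \sum_i f i x) = \sum_i f i.
  by apply/funext => x; rewrite fct_sumE.
apply: (big_ind (hardy Omega p)) => [|f1 f2|i _]; first exact: hardy0.
- exact: hardyD.
- exact: hf.
Qed.

(** Invariance of vector Hardy classes under bounded analytic multipliers: each
    entry of the product is a finite sum of products of an H_oo and an H_p
    function. *)
Lemma hardy_mx_mulmx p (m n q : nat) (A : R -> 'M[R[i]]_(m, n))
    (B : R -> 'M[R[i]]_(n, q)) : (1 <= p)%E ->
    hardy_mx Omega +oo A -> hardy_mx Omega p B ->
  hardy_mx Omega p (fun x => A x *m B x).
Proof.
move=> p1 hA hB i j; under eq_fun do rewrite mxE.
by apply: hardy_sum => // k; exact: (hardyM p1 (hA i k) (hB k j)).
Qed.

Lemma hardy_mx_ae p (m n : nat) (A B : R -> 'M[R[i]]_(m, n)) :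
    {ae lebesgue_measure, forall x : R, A x = B x} ->
  hardy_mx Omega p A -> hardy_mx Omega p B.
Proof.
by move=> AB hA i j; apply: hardy_ae (hA i j); apply: filterS AB => x ->.
Qed.

End HardyClasses.

(** * Decoupling by the factorization *)

Lemma horizontal_upper (R : realType) (x y : R) :
  @upper_half_plane R (0 +i* y) -> upper_half_plane (x +i* y).
Proof. by []. Qed.

Lemma horizontal_lower (R : realType) (x y : R) :
  @lower_half_plane R (0 +i* y) -> lower_half_plane (x +i* y).
Proof. by []. Qed.

Lemma mulmx_sum_colZ (R : comPzRingType) (m n : nat) (A : 'M[R]_(m, n))
    (v : 'cV[R]_n) : A *m v = \sum_(j < n) v j 0 *: col j A.
Proof.
apply/colP => i; rewrite mxE summxE; apply: eq_bigr => j _.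
by rewrite !mxE mulrC.
Qed.

Lemma mul_diag_fun (R : realType) (n : nat) (d : 'I_n -> R -> R[i]) (x : R)
  (v : 'cV[R[i]]_n) : diag_fun d x *m v = \col_j (d j x * v j 0).
Proof. by apply/colP => j; rewrite /diag_fun mul_diag_mx !mxE. Qed.

Unset Implicit Arguments.
Set Strict Implicit.

Theorem theorem2p1 (R : realType) (n : nat) (p : \bar R) (hp : (1 <= p)%E)
  (G Gm Gp : R -> 'M[R[i]]_n) (d : 'I_n -> R -> R[i])
  (hG : bounded_factorization G Gm d Gp)
  (g phip phim : R -> 'cV[R[i]]_n) :
  [/\ hardy_mx upper_half_plane p phip,
      hardy_mx lower_half_plane p phim &
      {ae lebesgue_measure, forall x : R, phim x = G x *m phip x + g x}]
  <->
  exists psi : 'I_n -> R -> R[i],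
    [/\ forall j : 'I_n,
          hardy upper_half_plane p (psi j) /\
          hardy lower_half_plane p
            (fun x => d j x * psi j x + (invmx (Gm x) *m g x) j 0),
        {ae lebesgue_measure, forall x : R,
          phip x = \sum_(j < n) psi j x *: col j (Gp x)} &
        {ae lebesgue_measure, forall x : R,
          phim x = \sum_(j < n) (d j x * psi j x) *: col j (Gm x) + g x}].
Proof.
case: hG => unit [hGp hGpV] [hGm hGmV] Gfact.
split=> [[hphip hphim eqphi]|[psi [hpsi eqphip eqphim]]].
  pose u x := invmx (Gp x) *m phip x.
  (* G_+^-1 is bounded, so psi stays in H_p^+. *)
  have hu : hardy_mx upper_half_plane p u.
    exact: hardy_mx_mulmx (@horizontal_upper R) _ _ _ _ _ _ hp hGpV hphip.
  have eqm : {ae lebesgue_measure, forall x : R,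
      phim x = Gm x *m (diag_fun d x *m u x) + g x}.
    apply: filterS2 Gfact eqphi => x Gx ->.
    by rewrite Gx !mulmxA.
  exists (fun j x => u x j 0); split.
  - move=> j; split; first exact: hu.
    (* The scalar expression is the j-th entry of G_-^-1 phi_-. *)
    have hw := hardy_mx_mulmx (@horizontal_lower R) hp hGmV hphim.
    apply: hardy_ae (hw j 0); apply: filterS2 unit eqm => x [_ Ux] ->.
    by rewrite mulmxDr mulKmx // mul_diag_fun !mxE.
  - by apply: filterS unit => x [Ux _]; rewrite -mulmx_sum_colZ mulKVmx.
  - apply: filterS eqm => x ->; rewrite mul_diag_fun mulmx_sum_colZ.
    by under eq_bigr do rewrite mxE.
pose u x : 'cV[R[i]]_n := \col_j psi j x.
have eqp : {ae lebesgue_measure, forall x : R, Gp x *m u x = phip x}.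
  apply: filterS eqphip => x ->; rewrite mulmx_sum_colZ.
  by under eq_bigr do rewrite mxE.
have eqm : {ae lebesgue_measure, forall x : R,
    Gm x *m (diag_fun d x *m u x) + g x = phim x}.
  apply: filterS eqphim => x ->; rewrite mul_diag_fun mulmx_sum_colZ.
  by under eq_bigr do rewrite !mxE.
split.
- apply: hardy_mx_ae eqp _.
  apply: hardy_mx_mulmx (@horizontal_upper R) _ _ _ _ _ _ hp hGp _ => i j.
  by apply: hardy_ae (proj1 (hpsi i)); apply: aeW => x; rewrite mxE.
- (* Factoring out G_- from phi_- leaves the vector of the n scalar
     expressions, each of which is in H_p^- by assumption. *)
  pose w x := diag_fun d x *m u x + invmx (Gm x) *m g x.
  apply: (@hardy_mx_ae _ _ _ _ _ (fun x => Gm x *m w x)).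
    apply: filterS2 unit eqm => x [_ Ux] <-.
    by rewrite mulmxDr mulKVmx.
  apply: hardy_mx_mulmx (@horizontal_lower R) _ _ _ _ _ _ hp hGm _ => i j.
  rewrite (ord1 j); apply: hardy_ae (proj2 (hpsi i)); apply: aeW => x.
  by rewrite /w mul_diag_fun !mxE.
- apply: filterS2 (filterI unit Gfact) (filterI eqp eqm).
  move=> x [[Ux _] Gx] [<- <-].
  by rewrite Gx !mulmxA mulmxKV.
Qed.
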